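(* Let $m\geq 3$ be an integer, let $\alpha\in\mathbb{F}_{2^{m+1}}\setminus\{0\}$, and let $V_\alpha=\mathbb{F}_{2^{m+1}}\setminus\{0,\alpha\}$. Let $U_{\alpha,2}=\{\{i,j\}\subseteq V_\alpha : i+j=\alpha\}$ and, for $3\leq k\leq 2^m-4$, $$U_{\alpha,k}=\{B\subseteq V_\alpha : |B|=k,\ \textstyle\sum_{x\in B}x=\alpha,\ B\cap(B+\alpha)=\emptyset\},$$ where $B+\alpha=\{x+\alpha:x\in B\}$. Let $\lambda_k$ denote the number of $k$-subsets $B$ of $\mathbb{F}_{2^m}\setminus\{0\}$ with $\sum_{x\in B}x=0$ that contain a given pair of distinct elements of $\mathbb{F}_{2^m}\setminus\{0\}$ (this number is independent of the pair). Then for each $3\leq k\leq 2^m-4$, the triple $(V_\alpha,U_{\alpha,2},U_{\alpha,k})$ is a $(k,\lambda_k')$-GDD with $\lambda_k'=2^{k-3}\lambda_k$.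
   Context: $\mathbb{F}_{q}$ denotes the finite field with $q$ elements. For positive integers $k,\lambda$, a $(k,\lambda)$-GDD (group divisible design) is a triple $(X,\mathcal{G},\mathcal{B})$ where $X$ is a finite set, $\mathcal{G}$ is a partition of $X$ into parts called groups, and $\mathcal{B}$ is a family of subsets of $X$ called blocks, such that (i) every block has exactly $k$ elements, (ii) every pair of distinct elements of $X$ occurs either in exactly $\lambda$ blocks or in one group, but not both, and (iii) $|\mathcal{G}|>1$. *)

(* Defs.v *)
From HB Require Import structures.
From mathcomp Require Import all_boot all_order all_algebra.
Set Implicit Arguments.
Unset Strict Implicit.
Unset Printing Implicit Defensive.
Import GRing.Theory.
Local Open Scope ring_scope.

Definition pair_degree (T : finType) (Bs : {set {set T}}) (x y : T) : nat :=
  #|[set B in Bs | (x \in B) && (y \in B)]|.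

Definition same_group (T : finType) (Gs : {set {set T}}) (x y : T) : Prop :=
  exists2 G : {set T}, G \in Gs & (x \in G) && (y \in G).

(* In [gdd_pairs], "in exactly lambda blocks or in one group, but not both" has
   its usual meaning in design theory: a pair of points that lies in a group
   lies in no block. As lambda > 0, this implies the exclusive disjunction of
   "in exactly lambda blocks" and "in a group". That the group is unique is part
   of [partition]. *)
Record is_GDD (T : finType) (X : {set T}) (Gs Bs : {set {set T}})
    (k lambda : nat) : Prop := IsGDD {
  gdd_k_gt0 : (0 < k)%N;
  gdd_lambda_gt0 : (0 < lambda)%N;
  gdd_groups : partition Gs X;
  gdd_blocks : forall B : {set T}, B \in Bs -> B \subset X;
  gdd_block_size : forall B : {set T}, B \in Bs -> #|B| = k;
  gdd_pairs : forall x y : T, x \in X -> y \in X -> x != y ->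
    (pair_degree Bs x y = lambda /\ ~ same_group Gs x y) \/
    (pair_degree Bs x y = 0%N /\ same_group Gs x y);
  gdd_groups_gt1 : (1 < #|Gs|)%N
}.

Definition Vset (F : finFieldType) (alpha : F) : {set F} :=
  ~: [set 0; alpha].

Definition Ugroups (F : finFieldType) (alpha : F) : {set {set F}} :=
  [set [set i; j] | i in Vset alpha, j in Vset alpha & i + j == alpha].

Definition Ublocks (F : finFieldType) (alpha : F) (k : nat) : {set {set F}} :=
  [set B : {set F} | [&& B \subset Vset alpha,
                         #|B| == k,
                         \sum_(x in B) x == alpha &
                         B :&: [set x + alpha | x in B] == set0]].

Definition zero_sum_sets (K : finFieldType) (k : nat) : {set {set K}} :=
  [set B : {set K} | [&& B \subset ~: [set 0],
                         #|B| == k &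
                         \sum_(x in B) x == 0]].

(* Main.v *)
Require Import Defs.
From mathcomp Require Import all_boot all_order all_algebra all_field.
From mathcomp Require Import zify ring.
Import GRing.Theory.
Local Open Scope ring_scope.
Set Implicit Arguments.
Unset Strict Implicit.
Unset Printing Implicit Defensive.

(** Over [F_2], if [x], [y], [alpha] are independent in [F] and [a], [b] are
    independent in [K], then some linear surjection [p : F -> K] has kernel
    [{0, alpha}] and maps [x], [y] to [a], [b]. The blocks through [x] and [y] are
    the lifts along [p] with sum [alpha] of the zero-sum [k]-sets through [a] and
    [b]. Such a set has [2 ^ (k - 2)] lifts through [x] and [y], half of them with
    sum [alpha]. As the pairs [(x, y)] and [(a, b)] are arbitrary, this identity
    also shows that the pair degree in [K] is constant.
    The degree is positive because a zero-sum [k]-set exists: depending on [k]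
    modulo 4, it is the union of a small explicit set and of pairs [{x, x + s}]. *)

(** * Linear algebra over F_2: a quotient map with prescribed values *)

Lemma basis_extension (k : fieldType) (V : vectType k) (X : seq V) :
  free X ->
  exists2 Z, basis_of fullv (X ++ Z) & (size X + size Z)%N = \dim {:V}.
Proof.
move=> freeX; exists (vbasis (<<X>>^C)%VS).
  rewrite -(addv_complf <<X>>%VS); apply: cat_basis; last exact: vbasisP.
    by apply/directv_addP; rewrite capv_compl.
  by rewrite /basis_of freeX eqxx.
by rewrite size_tuple dimv_compl (eqP freeX) subnKC // -(eqP freeX) dimvS ?subvf.
Qed.

(** Extend both families to bases, send [v] to 0 and match the remaining basis vectors in order. The
    image contains a basis of [W], and rank-nullity leaves a kernel of dimension one, which contains
    [v]. *)
Lemma linear_surjection_with_line_kernel (k : fieldType) (V W : vectType k)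
    (v : V) (X : seq V) (Y : seq W) :
  free (v :: X) -> free Y -> size X = size Y -> \dim {:V} = (\dim {:W}).+1 ->
  exists f : {linear V -> W},
    [/\ map f X = Y, forall w, exists u, f u = w
      & forall u, (f u == 0) = (u \in <[v]>%VS)].
Proof.
move=> freeX freeY eqXY dimVW.
have [Z baseXZ sizeXZ] := basis_extension freeX.
have [T baseYT sizeYT] := basis_extension freeY.
have eqZT : size Z = size T.
  by move: sizeXZ; rewrite dimVW -sizeYT /= eqXY => -[] /addnI.
have [f fP] := linear_of_free ((v :: X) ++ Z) (0 :: Y ++ T).
have /= := fP (basis_free baseXZ) _.
rewrite !size_cat eqXY eqZT => /(_ erefl) [fv0].
rewrite map_cat => /eqP; rewrite eqseq_cat ?size_map // => /andP[/eqP fX /eqP fZ].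
have imf : limg (linfun f) = fullv.
  rewrite -(span_basis baseXZ) limg_span (eq_map (lfunE f)) map_cat /= fv0 fX fZ.
  by rewrite span_cons (span_basis baseYT) addvC addv0.
have kerf : lker (linfun f) = <[v]>%VS.
  apply/eqP; rewrite eq_sym eqEdim -memvE memv_ker lfunE /= fv0 eqxx /=.
  rewrite dim_vline (_ : v != 0); last first.
    by apply: contraTneq freeX => ->; rewrite free_cons mem0v.
  have := limg_ker_dim (linfun f) fullv; rewrite imf dimVW capfv.
  by rewrite -add1n => /addIn ->.
exists f; split=> // [w|u].
  have : w \in limg (linfun f) by rewrite imf memvf.
  by case/memv_imgP=> u _ ->; exists u; rewrite lfunE.
by rewrite -kerf memv_ker lfunE.
Qed.

Lemma F2_cases (c : 'F_2) : c = 0 \/ c = 1.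
Proof. by case: c => [[|[|//]] ?]; [left | right]; apply: val_inj. Qed.

Lemma free_pair_F2 (V : vectType 'F_2) (x y : V) :
  x != 0 -> y != 0 -> x != y -> free [:: x; y].
Proof.
move=> x0 y0 xy; rewrite free_cons seq1_free y0 andbT span_seq1.
apply/vlineP=> -[c xE]; move: x0 xy; rewrite {x}xE.
by case: (F2_cases c) => ->; rewrite ?scale0r ?scale1r eqxx.
Qed.

(** With scalars 0 and 1 only, the excluded list is the whole span of [x] and [y]. *)
Lemma free_triple_F2 (V : vectType 'F_2) (z x y : V) :
  free [:: x; y] -> z \notin [:: 0; x; y; x + y] -> free [:: z; x; y].
Proof.
move=> freexy; rewrite free_cons freexy andbT; apply: contraNN.
rewrite span_cons span_seq1.
case/memv_addP=> _ /vlineP[c ->] [_ /vlineP[d ->] ->].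
case: (F2_cases c) => ->; case: (F2_cases d) => ->;
  by rewrite ?scale0r ?scale1r ?add0r ?addr0 !inE eqxx ?orbT.
Qed.

(** Regarded as F_2-spaces, [F] and [K] have dimensions m + 1 and m, and the line spanned by [alpha]
    is [{0, alpha}]. *)
Lemma additive_quotient_map (m : nat) (F K : finFieldType) (alpha x y : F)
    (a b : K) :
  #|F| = (2 ^ m.+1)%N -> #|K| = (2 ^ m)%N ->
  x != 0 -> y != 0 -> x != y -> alpha \notin [:: 0; x; y; x + y] ->
  a != 0 -> b != 0 -> a != b ->
  exists p : {additive F -> K},
    [/\ p x = a, p y = b, forall w, exists u, p u = w
      & forall u, (p u == 0) = (u == 0) || (u == alpha)].
Proof.
move=> cardF cardK x0 y0 xy alphaP a0 b0 ab.
have charF := card_finPcharP cardF isT; have charK := card_finPcharP cardK isT.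
pose V := pPrimeCharType charF; pose W := pPrimeCharType charK.
have dimVW : \dim {:V} = (\dim {:W}).+1.
  by rewrite !pprimeChar_dimf cardF cardK !lognX logn_prime // !muln1.
have freeX := free_triple_F2 (free_pair_F2 (V := V) x0 y0 xy) alphaP.
have freeY := free_pair_F2 (V := W) a0 b0 ab.
have [f [[fx fy] fsurj fker]] :=
  linear_surjection_with_line_kernel freeX freeY erefl dimVW.
exists (f : {additive V -> W}); split=> // u.
rewrite [LHS]fker; apply/vlineP/orP.
  case=> c ->; case: (F2_cases c) => ->; rewrite ?scale0r ?scale1r eqxx;
  by [left | right].
case=> /eqP ->; first by exists 0; rewrite scale0r.
by exists 1; rewrite scale1r.
Qed.

(** * Lifting zero-sum sets along the quotient map *)

Section LiftingBlocks.

Variables (F K : finFieldType) (alpha : F) (p : {additive F -> K}).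
Hypotheses (char2F : 2%N \in [pchar F]) (alpha_neq0 : alpha != 0).
Hypothesis p_surj : forall w, exists u, p u = w.
Hypothesis p_ker : forall u, (p u == 0) = (u == 0) || (u == alpha).

Lemma eq_fiber u v : (p u == p v) = (u == v) || (u == v + alpha).
Proof. by rewrite -subr_eq0 -raddfB p_ker subr_eq0 subr_eq (addrC alpha). Qed.

Lemma p_addalpha u : p (u + alpha) = p u.
Proof. by apply/eqP; rewrite eq_fiber eqxx orbT. Qed.

(** The fibres of [p] are the pairs [{u, u + alpha}]. So [B] is disjoint from its translate iff [p]
    is injective on [B], and it avoids 0 and [alpha] iff its image avoids 0. The sum condition must
    stay: a zero-sum image only gives a sum in [{0, alpha}]. *)
Lemma UblocksP (B : {set F}) (k : nat) :
  reflect [/\ {in B &, injective p}, p @: B \in zero_sum_sets K k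
            & \sum_(u in B) u = alpha]
          (B \in Ublocks alpha k).
Proof.
rewrite [B \in _]inE; apply: (iffP and4P).
  case=> sBV /eqP cardB /eqP sumB /eqP disjB.
  have injp : {in B &, injective p}.
    move=> u v uB vB /eqP; rewrite eq_fiber => /orP[/eqP// | /eqP uv].
    by have := in_set0 u; rewrite -disjB inE uB uv (imset_f (+%R^~ alpha)).
  split=> //; rewrite inE card_in_imset // cardB eqxx big_imset //= -raddf_sum.
  rewrite sumB p_ker eqxx orbT !andbT.
  apply/subsetP=> _ /imsetP[u /(subsetP sBV) uV ->].
  by move: uV; rewrite !inE p_ker.
case=> injp; rewrite inE => /and3P[/subsetP pB /eqP cardpB _] sumB; split.
- by apply/subsetP=> u /(imset_f p) /pB; rewrite !inE p_ker.
- by rewrite -cardpB card_in_imset.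
- exact/eqP.
apply/eqP/setP=> u; rewrite !inE; apply/andP=> -[uB /imsetP[v vB uE]].
have uv : u = v by apply: injp => //; rewrite uE p_addalpha.
move/eqP: uE; rewrite uv -[X in X == _]addr0 (inj_eq (addrI v)) eq_sym.
by rewrite (negPf alpha_neq0).
Qed.

(** With such a section, a lift goes through [x] and [y] exactly when it is unshifted over [p x] and
    [p y]. *)
Lemma section_through x y : p x != p y ->
  exists s : K -> F, [/\ cancel s p, s (p x) = x & s (p y) = y].
Proof.
move=> pxy.
have /fin_all_exists[s sP] : forall w, exists u,
    [/\ p u = w, w = p x -> u = x & w = p y -> u = y].
  move=> w; have [->|wx] := eqVneq w (p x).
    by exists x; split=> // /eqP; rewrite (negPf pxy).
  have [->|wy] := eqVneq w (p y).
    by exists y; split=> // /eqP; rewrite eq_sym (negPf pxy).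
  have [u pu] := p_surj w; exists u.
  by split=> // /eqP; rewrite ?(negPf wx) ?(negPf wy).
exists s; split=> [w||]; first by case: (sP w).
  by case: (sP (p x)) => _ ->.
by case: (sP (p y)) => _ _ ->.
Qed.

(** Over each [c] lie the two points [s c] and [s c + alpha]; [T] marks where the second is chosen,
    so that lifts of [C] are encoded by subsets of [C]. *)
Definition lift_set (s : K -> F) (C T : {set K}) : {set F} :=
  [set s c + alpha *+ (c \in T) | c in C].

Section LiftingAlongASection.

Variable s : K -> F.
Hypothesis sK : cancel s p.

Lemma p_lift c (b : bool) : p (s c + alpha *+ b) = c.
Proof. by case: b; rewrite ?addr0 ?p_addalpha sK. Qed.

Lemma lift_inj (T : {set K}) : injective (fun c => s c + alpha *+ (c \in T)).
Proof. by move=> c d /(congr1 p); rewrite !p_lift. Qed.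

Lemma p_lift_set (C T : {set K}) : p @: lift_set s C T = C.
Proof.
rewrite -imset_comp -[RHS]imset_id.
by apply: eq_imset => c /=; rewrite p_lift.
Qed.

Lemma p_lift_set_inj (C T : {set K}) : {in lift_set s C T &, injective p}.
Proof.
by move=> _ _ /imsetP[c _ ->] /imsetP[d _ ->]; rewrite !p_lift => ->.
Qed.

Lemma mem_lift_set (C T : {set K}) c :
  c \in C -> (s c \in lift_set s C T) = (c \notin T).
Proof.
move=> cC; apply/imsetP/idP => [[d _ sc]|cT].
  have cd : c = d by rewrite -[LHS]sK sc p_lift.
  move/eqP: sc; rewrite cd; case: (d \in T) => //.
  rewrite -[X in X == _]addr0 (inj_eq (addrI _)) eq_sym.
  by rewrite (negPf alpha_neq0).
by exists c => //; rewrite (negPf cT) addr0.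
Qed.

(** Both sets have as many elements as [C], so one inclusion suffices: if [s c] is not in [B], the
    point of [B] over [c] is [s c + alpha]. *)
Lemma lift_set_eq (B : {set F}) (C T : {set K}) :
  {in B &, injective p} -> p @: B = C ->
  {in C, forall c, (c \in T) = (s c \notin B)} -> lift_set s C T = B.
Proof.
move=> injp pB CT; apply/eqP; rewrite eqEcard.
rewrite -(card_in_imset injp).
rewrite -[X in (_ <= X)%N](card_in_imset (@p_lift_set_inj C T)).
rewrite p_lift_set pB leqnn andbT.
apply/subsetP=> _ /imsetP[c cC ->]; rewrite CT //.
have [scB|scB] := boolP (s c \in B); first by rewrite addr0.
have [u uB cE] : exists2 u, u \in B & c = p u by apply/imsetP; rewrite pB.
have /eqP := sK (p u); rewrite eq_fiber -cE => /orP[]/eqP sc.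
  by rewrite sc uB in scB.
by rewrite sc mulr1n -addrA addrr_pchar2 // addr0.
Qed.

(** Only the term over [z] changes; the choice over a single point can thus correct the sum. *)
Lemma sum_lift_set_toggle (C S : {set K}) z : z \in C -> z \notin S ->
  \sum_(u in lift_set s C (z |: S)) u = \sum_(u in lift_set s C S) u + alpha.
Proof.
move=> zC zS; rewrite !big_imset /=; try by move=> ? ? _ _; apply: lift_inj.
rewrite (bigD1 z) //= [in RHS](bigD1 z) //= setU11 (negPf zS) addr0 mulr1n.
rewrite addrAC; congr (_ + _ + _); apply: eq_bigr => c /andP[_ cz].
by rewrite !inE (negPf cz).
Qed.

End LiftingAlongASection.

(** Over [p x] and [p y] the lift is prescribed, over one further point [z] the sum forces it, and
    over the other k - 3 points it is free. The map [G] below makes this a bijection from the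
    subsets of those points. *)
Lemma card_lifted_blocks (k : nat) (C : {set K}) x y : (3 <= k)%N ->
  C \in zero_sum_sets K k -> p x != p y -> p x \in C -> p y \in C ->
  #|[set B in Ublocks alpha k | [&& x \in B, y \in B & p @: B == C]]|
    = (2 ^ (k - 3))%N.
Proof.
move=> k3 CZ pxy pxC pyC; have [s [sK sx sy]] := section_through pxy.
have /and3P[_ /eqP cardC /eqP sumC] : [&& C \subset ~: [set 0], #|C| == k
  & \sum_(c in C) c == 0] by rewrite inE in CZ.
have cardC2 : #|C :\ p x :\ p y| = (k - 2)%N.
  by move: cardC; rewrite (cardsD1 (p x)) pxC (cardsD1 (p y)) !inE eq_sym pxy pyC
    => <-; rewrite addnA addKn.
have /card_gt0P[z] : (0 < #|C :\ p x :\ p y|)%N by rewrite cardC2 subn_gt0.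
rewrite !inE => /and3P[zy zx zC]; pose D := C :\ p x :\ p y :\ z.
have cardD : #|D| = (k - 3)%N.
  rewrite (_ : k - 3 = (k - 2).-1)%N; last by rewrite -subnS.
  by rewrite -cardC2 [in RHS](cardsD1 z) !inE zy zx zC.
have DC c : c \in D -> c \in C by rewrite !inE => /and4P[].
have Dz c : c \in D -> c != z by rewrite !inE => /and4P[].
(* Each choice of lifts over [D] extends in exactly two ways to [z], and the two
   extensions have sums differing by [alpha]. *)
pose G S := let B := lift_set s C S in
  if \sum_(u in B) u == alpha then B else lift_set s C (z |: S).
(* [S] can be read off from [G S], which gives injectivity. *)
have memG S c : c \in D -> (s c \in G S) = (c \notin S).
  move=> cD; rewrite /G; case: ifP => _; rewrite mem_lift_set ?DC //.
  by rewrite !inE (negPf (Dz _ cD)).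
have sub_notin S c : S \in powerset D -> c \notin D -> c \notin S.
  by rewrite inE => /subsetP SD; apply: contraNN => /SD.
have zS S : S \in powerset D -> z \notin S.
  by move=> SD; apply: sub_notin SD _; rewrite !inE eqxx.
rewrite -cardD -card_powerset -(@card_in_imset _ _ G); last first.
  move=> S S' SD S'D eqG; apply/setP=> c.
  have [cD|cD] := boolP (c \in D); last first.
    by rewrite (negPf (sub_notin _ _ SD cD)) (negPf (sub_notin _ _ S'D cD)).
  by apply: negb_inj; rewrite -!memG // eqG.
apply: eq_card => B; rewrite [LHS]inE; apply/idP/imsetP; last first.
  case=> S SD ->.
  (* Outside [D] and [z] nothing is shifted; this applies to [x] and [y]. *)
  have mG u : s (p u) = u -> p u \in C -> p u != z -> p u \notin D -> u \in G S.
    move=> su uC uz uD; rewrite -su /G.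
    have uS := sub_notin _ _ SD uD.
    by case: ifP => _; rewrite mem_lift_set // !inE negb_or ?uz.
  have xG : x \in G S by apply: mG; rewrite // 1?eq_sym // !inE eqxx !andbF.
  have yG : y \in G S by apply: mG; rewrite // 1?eq_sym // !inE eqxx !andbF.
  have sumG : \sum_(u in G S) u = alpha.
    rewrite /G; case: ifP => [/eqP //|sumS].
    rewrite sum_lift_set_toggle ?zS //; set S0 := \sum_(u in _) u in sumS *.
    (* [C] has sum zero, so the sum of its lift lies in the kernel; not being [alpha], it is 0, and
       the shift over [z] turns it into [alpha]. *)
    have : p S0 == 0.
      rewrite raddf_sum -(big_imset id (@p_lift_set_inj s sK C S)) /=.
      by rewrite p_lift_set // sumC.
    by rewrite p_ker sumS orbF => /eqP ->; rewrite add0r.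
  have pG : p @: G S = C by rewrite /G; case: ifP => _; rewrite p_lift_set.
  rewrite xG yG pG eqxx !andbT; apply/UblocksP; rewrite pG; split=> //.
  by rewrite /G; case: ifP => _; apply: p_lift_set_inj.
case/andP=> /UblocksP[injp _ sumB] /and3P[xB yB /eqP pB].
(* The preimage of [B] under [G]: the points of [D] over which [B] contains the shifted lift. *)
pose S := [set c in D | s c \notin B].
have SD : S \in powerset D.
  by rewrite inE; apply/subsetP=> c; rewrite inE => /andP[].
exists S => //; rewrite /G.
have memS c : c \in C -> c != z -> (c \in S) = (s c \notin B).
  move=> cC cz; rewrite !inE cC cz /= andbT.
  have [->|] := eqVneq c (p y); first by rewrite sy yB.
  by have [->|] := eqVneq c (p x); first by rewrite sx xB.
have [szB|szB] := boolP (s z \in B).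
  rewrite (lift_set_eq sK injp pB) ?sumB ?eqxx // => c cC.
  by have [->|/memS->//] := eqVneq c z; rewrite (negPf (zS _ SD)) szB.
have lB : lift_set s C (z |: S) = B.
  apply: lift_set_eq => // c cC; rewrite in_setU1.
  by have [->|/(memS _ cC)<-] := eqVneq c z; first by rewrite szB.
(* If the lift unshifted over [z] also had sum [alpha], then [B] would have sum
   [alpha + alpha = 0]. *)
rewrite lB; case: eqP => // sumS.
have := sum_lift_set_toggle sK zC (zS _ SD); rewrite lB sumB sumS addrr_pchar2 //.
by move/eqP; rewrite (negPf alpha_neq0).
Qed.

(** Sort the blocks through [x] and [y] by their image under [p]; every class has the same size. *)
Lemma pair_degree_Ublocks (k : nat) x y : (3 <= k)%N -> p x != p y ->
  pair_degree (Ublocks alpha k) x y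
    = (2 ^ (k - 3) * pair_degree (zero_sum_sets K k) (p x) (p y))%N.
Proof.
move=> k3 pxy; rewrite /pair_degree -sum1_card.
rewrite (partition_big (fun B : {set F} => p @: B)
  [in [set C in zero_sum_sets K k | (p x \in C) && (p y \in C)]]) /=; last first.
  move=> B; rewrite inE => /and3P[/UblocksP[_ pBZ _] xB yB].
  by rewrite inE pBZ !imset_f.
rewrite mulnC -sum_nat_const; apply: eq_bigr => C.
rewrite [C \in _]inE => /and3P[CZ pxC pyC].
rewrite -(card_lifted_blocks k3 CZ pxy pxC pyC) -sum1_card.
by apply: eq_bigl => B; rewrite [in RHS]in_set in_set -!andbA.
Qed.

End LiftingBlocks.

(** * Existence of zero-sum sets *)

(** A set of size 0, 1, 3 or 4 is to be completed by [r] pairs [{x, x + s}], whose sum depends on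
    the parity of [r]. The summands 2 and 8 reserve room for the small set and its translate. *)
Lemma pair_count_mod4 (n k : nat) :
  (4 %| n)%N -> (8 <= n)%N -> (3 <= k)%N -> (k <= n - 4)%N ->
  exists r, [\/ [/\ k = 0 + r * 2, ~~ odd r & r * 2 + 2 <= n],
                [/\ k = 1 + r * 2, odd r & r * 2 + 2 <= n],
                [/\ k = 3 + r * 2, odd r & r * 2 + 8 <= n]
              | [/\ k = 4 + r * 2, odd r & r * 2 + 8 <= n]]%N.
Proof.
move=> /dvdnP[q ->] n8 k3 kn; have := ltn_pmod k (isT : 0 < 4)%N.
have := divn_eq k 4; move: (k %/ 4)%N => j.
case: (k %% 4)%N => [|[|[|[|//]]]] kE _.
- by exists (2 * j)%N; constructor 1; split; lia.
- by exists (2 * j - 1)%N; constructor 3; split; lia.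
- by exists (2 * j - 1)%N; constructor 4; split; lia.
- by exists (2 * j + 1)%N; constructor 2; split; lia.
Qed.

Section ZeroSumSets.

Variable K : finFieldType.
Hypothesis char2K : 2%N \in [pchar K].
Implicit Types (s t x y : K) (A D P Q : {set K}) (r : nat).

Lemma addr_eq_char2 s x y : (x + s == y) = (x == y + s).
Proof. by rewrite -subr_eq oppr_pchar2. Qed.

Lemma mulrn_char2 s r : s *+ r = s *+ odd r.
Proof.
rewrite -{1}(odd_double_half r) mulrnDr -mul2n mulrnA mulr2n addrr_pchar2 //.
by rewrite mul0rn addr0.
Qed.

(** Pairs [{x, x + s}] are added one at a time, each contributing [s] to the sum. *)
Lemma translation_closed_subset s P r : s != 0 ->
  {in P, forall x, x + s \in P} -> (r * 2 <= #|P|)%N ->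
  exists Q, [/\ Q \subset P, {in Q, forall x, x + s \in Q}, #|Q| = (r * 2)%N
              & \sum_(x in Q) x = s *+ r].
Proof.
move=> s0 Ps; elim: r => [|r IHr] leP.
  by exists set0; rewrite sub0set cards0 big_set0; split=> // x; rewrite inE.
have [Q [sQP Qs cardQ sumQ]] := IHr ltac:(lia).
have /subsetPn[x xP xQ] : ~~ (P \subset Q).
  by apply/negP => /subset_leq_card; lia.
have xsQ : x + s \notin Q.
  by apply: contraNN xQ => /Qs; rewrite -addrA addrr_pchar2 ?addr0.
have xD : x \notin (x + s) |: Q.
  rewrite !inE negb_or xQ andbT -[X in X == _]addr0 (inj_eq (addrI x)) eq_sym.
  exact: s0.
exists (x |: ((x + s) |: Q)); split.
- by rewrite !subUset !sub1set xP Ps.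
- move=> y; rewrite !inE => /or3P[/eqP->|/eqP->|/Qs->]; rewrite ?orbT //.
    by rewrite eqxx orbT.
  by rewrite -addrA addrr_pchar2 // addr0 eqxx.
- by rewrite !cardsU1 xD xsQ cardQ; lia.
by rewrite !big_setU1 //= sumQ !addrA addrr_pchar2 // add0r mulrS.
Qed.

(** [D] lies in the union of [A] and [A + s]. The complement is stable under translation by [s],
    avoids 0, and has room for [r] pairs; their sum [s *+ r] cancels that of [D]. *)
Lemma zero_sum_set_from_base s A D r : s != 0 -> 0 \in A -> 0 \notin D ->
  {in D, forall d, (d \in A) || (d + s \in A)} ->
  (r * 2 + #|A| * 2 <= #|K|)%N -> \sum_(d in D) d = s *+ r ->
  exists C, C \in zero_sum_sets K (#|D| + r * 2).
Proof.
move=> s0 A0 D0 DA leK sumD; pose P := ~: (A :|: [set a + s | a in A]).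
have Ps : {in P, forall x, x + s \in P}.
  move=> x; rewrite !inE; apply: contraNN => /orP[xsA|/imsetP[a aA /addIr ->]].
    apply/orP; right; apply/imsetP; exists (x + s) => //.
    by rewrite -addrA addrr_pchar2 ?addr0.
  by rewrite aA.
have leP : (r * 2 <= #|P|)%N.
  rewrite /P; set A' := [set a + s | a in A].
  have leA' : (#|A'| <= #|A|)%N by exact: leq_imset_card.
  have [leU _] := leq_card_setU A A'.
  rewrite -(leq_add2l #|A :|: A'|) cardsC; apply: leq_trans leK.
  by rewrite addnC leq_add2l muln2 -addnn (leq_trans leU) ?leq_add2l.
have [Q [sQP _ cardQ sumQ]] := translation_closed_subset s0 Ps leP.
have disj : [disjoint D & Q].
  rewrite disjoint_subset; apply/subsetP=> d /DA dA; apply/negP => /(subsetP sQP).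
  rewrite !inE negb_or; case/orP: dA => [->//|dsA] /andP[_ /imsetP[]].
  by exists (d + s) => //; rewrite -addrA addrr_pchar2 ?addr0.
exists (D :|: Q); rewrite inE cardsU (disjoint_setI0 disj) cards0 subn0 cardQ.
rewrite eqxx.
rewrite (eq_bigl [in [predU D & Q]]) => [|x]; last by rewrite !inE.
rewrite bigU //= sumD sumQ addrr_pchar2 // eqxx !andbT.
apply/subsetP=> x; rewrite !inE => /orP[|/(subsetP sQP)].
  by apply: contraTneq => ->.
by rewrite !inE; apply: contraNneq => ->; rewrite A0.
Qed.

Lemma exists_notin (l : seq K) : (size l < #|K|)%N -> exists x, x \notin l.
Proof.
move=> lt_l; have /subsetPn[x _ xl] : ~~ (predT \subset l).
  apply/negP => /subset_leq_card /leq_trans/(_ (card_size l)).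
  by rewrite leqNgt lt_l.
by exists x.
Qed.

Lemma zero_sum_set_exists (k : nat) : (4 %| #|K|)%N -> (8 <= #|K|)%N ->
  (3 <= k)%N -> (k <= #|K| - 4)%N -> exists C, C \in zero_sum_sets K k.
Proof.
move=> dvdK cardK k3 kK; have [r kE] := pair_count_mod4 dvdK cardK k3 kK.
(* The elements [s], [t], [b] are chosen independent over F_2. *)
have [s] : exists s, s \notin [:: 0 : K].
  by apply: exists_notin; apply: leq_trans cardK.
have [t] : exists t, t \notin [:: 0; s].
  by apply: exists_notin; apply: leq_trans cardK.
have [b] : exists b, b \notin [:: 0; s; t; t + s].
  by apply: exists_notin; apply: leq_trans cardK.
rewrite !inE !negb_or => /and4P[b0 bs bt bts] /andP[t0 ts] s0.
(* The span of [t] and [b]; with its translate by [s] it fills the span of all three. *)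
pose A := [set x in [:: 0; t; b; b + t]].
have cardA : (#|A| <= 4)%N by rewrite cardsE card_size.
have A0 : 0 \in A by rewrite !inE eqxx.
have addl_eq x y : (x == x + y) = (y == 0).
  by rewrite -[X in X == _]addr0 (inj_eq (addrI x)) eq_sym.
have bts_neq : b + s != b + t + s.
  by rewrite (inj_eq (addIr s)) addl_eq.
have addss x : x + s + s = x by rewrite -addrA addrr_pchar2 ?addr0.
have odd_sum : odd r -> s *+ r = s by rewrite mulrn_char2 => ->.
have leA : (r * 2 + 8 <= #|K|)%N -> (r * 2 + #|A| * 2 <= #|K|)%N.
  by apply: leq_trans; rewrite leq_add2l (leq_mul2r 2 _ 4).
(* The base sets of sizes 0, 1, 3, 4 have sums 0, [s], [s], [s], which is [s *+ r] by the parity of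
   [r]. *)
case: kE => [][-> odd_r leK].
- have := @zero_sum_set_from_base s [set 0] set0 r.
  rewrite cards0 cards1 big_set0 mulrn_char2 (negPf odd_r).
  by apply=> //; [rewrite !inE | rewrite inE | move=> d; rewrite inE].
- have := @zero_sum_set_from_base s [set 0] [set s] r.
  rewrite !cards1 big_set1 odd_sum //; apply=> //.
  + by rewrite inE.
  + by rewrite inE eq_sym.
  by move=> d; rewrite !inE => /eqP ->; rewrite addrr_pchar2 // eqxx orbT.
- have D1 : b + t + s \notin [set t + s].
    by rewrite inE (inj_eq (addIr s)) eq_sym addrC addl_eq.
  have D2 : b + s \notin b + t + s |: [set t + s].
    by rewrite !inE negb_or bts_neq (inj_eq (addIr s)).
  have := @zero_sum_set_from_base s A (b + s |: (b + t + s |: [set t + s])) r.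
  rewrite !big_setU1 // !cardsU1 cards1 big_set1 D1 D2 odd_sum //.
  apply=> //; last 1 first.
  (* The rearrangement holds in every commutative ring; characteristic two then removes the doubled
     term. *)
  + rewrite /= [LHS](_ : _ = s + ((b + t + s) + (b + t + s))); last by ring.
    by rewrite addrr_pchar2 // addr0.
  + rewrite !inE ![0 == _]eq_sym !addr_eq_char2 !add0r !negb_or bs ts andbT.
    by rewrite addrC.
  + by move=> d; rewrite !inE => /or3P[]/eqP->; rewrite addss eqxx !orbT.
  exact: leA.
have D1 : s \notin [set t] by rewrite inE eq_sym.
have D2 : b + t + s \notin s |: [set t].
  rewrite !inE negb_or !addr_eq_char2 addrr_pchar2 // add0r bt.
  by rewrite addrAC addrr_pchar2 // add0r.
have D3 : b + s \notin b + t + s |: (s |: [set t]).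
  by rewrite !inE !negb_or bts_neq !addr_eq_char2 addrr_pchar2 ?b0.
have := @zero_sum_set_from_base s A (b + s |: (b + t + s |: (s |: [set t]))) r.
rewrite !big_setU1 // !cardsU1 cards1 big_set1 D1 D2 D3 odd_sum //.
apply=> //; last 1 first.
- rewrite /= [LHS](_ : _ = s + ((b + t + s) + (b + t + s))); last by ring.
  by rewrite addrr_pchar2 // addr0.
- rewrite !inE ![0 == _]eq_sym !addr_eq_char2 !add0r !negb_or bs s0 t0.
  by rewrite (addrC s) bts.
- move=> d; rewrite !inE => /or4P[]/eqP->;
  by rewrite ?addss ?(addrr_pchar2 char2K s) eqxx ?orbT.
exact: leA.
Qed.

End ZeroSumSets.

(** * The groups as cosets *)

Section Groups.

Variables (F : finFieldType) (alpha : F).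
Hypotheses (char2F : 2%N \in [pchar F]) (alpha_neq0 : alpha != 0).

Lemma mem_Vset x : (x \in Vset alpha) = (x != 0) && (x != alpha).
Proof. by rewrite !inE negb_or. Qed.

Lemma Vset_addalpha x : x \in Vset alpha -> x + alpha \in Vset alpha.
Proof.
rewrite !mem_Vset !addr_eq_char2 // add0r addrr_pchar2 //.
by rewrite andbC.
Qed.

(** In characteristic two [i + j = alpha] means [j = i + alpha], so the groups are the cosets of
    [{0, alpha}] other than this subgroup. *)
Lemma UgroupsP (G : {set F}) :
  reflect (exists2 x, x \in Vset alpha & G = [set x; x + alpha])
          (G \in Ugroups alpha).
Proof.
apply: (iffP imset2P) => [[x y xV]|[x xV ->]].
  rewrite inE addrC => /andP[_]; rewrite addr_eq_char2 // => /eqP -> ->.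
  by exists x; rewrite // addrC.
exists x (x + alpha) => //.
by rewrite inE Vset_addalpha // addrA addrr_pchar2 // add0r eqxx.
Qed.

Lemma mem_group (x u : F) :
  (u \in [set x; x + alpha]) = (u == x) || (u == x + alpha).
Proof. by rewrite !inE. Qed.

Lemma group_eq x u : u \in [set x; x + alpha] ->
  [set x; x + alpha] = [set u; u + alpha].
Proof.
rewrite mem_group => /orP[]/eqP-> //.
by rewrite -addrA addrr_pchar2 // addr0 setUC.
Qed.

Lemma same_group_Ugroups x y : x \in Vset alpha -> x != y ->
  same_group (Ugroups alpha) x y <-> x + y = alpha.
Proof.
move=> xV xy; split.
  case=> _ /UgroupsP[z _ ->] /andP[/group_eq->]; rewrite mem_group eq_sym.
  rewrite (negPf xy) => /eqP ->.
  by rewrite addrA addrr_pchar2 // add0r.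
move=> xyE; exists [set x; x + alpha]; first by apply/UgroupsP; exists x.
rewrite !mem_group eqxx /= -xyE addrA addrr_pchar2 // add0r.
by rewrite eqxx orbT.
Qed.

Lemma partition_Ugroups : partition (Ugroups alpha) (Vset alpha).
Proof.
apply/and3P; split.
- apply/eqP/setP=> u; apply/bigcupP/idP.
    case=> _ /UgroupsP[x xV ->]; rewrite mem_group => /orP[]/eqP-> //.
    exact: Vset_addalpha.
  move=> uV; exists [set u; u + alpha]; first by apply/UgroupsP; exists u.
  by rewrite mem_group eqxx.
- apply/trivIsetP=> _ _ /UgroupsP[x _ ->] /UgroupsP[y _ ->].
  apply: contraR => /pred0Pn[u /andP[/= ux uy]].
  by rewrite (group_eq ux) (group_eq uy).
apply/negP=> /UgroupsP[x _ /setP/(_ x)].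
by rewrite mem_group eqxx in_set0.
Qed.

(** A block with both points would meet its translate in [x + alpha]. *)
Lemma pair_degree_same_group k x :
  pair_degree (Ublocks alpha k) x (x + alpha) = 0%N.
Proof.
apply/eqP; rewrite cards_eq0; apply/eqP/setP=> B; rewrite in_set0 inE.
apply/negP=> /and3P[]; rewrite inE => /and4P[_ _ _ /eqP/setP/(_ (x + alpha))].
by rewrite in_set0 inE => + xB yB; rewrite yB (imset_f (+%R^~ alpha)).
Qed.

End Groups.

(** * Pair degrees and the design *)

Lemma nonzero_pair_exists (K : finFieldType) : (2 < #|K|)%N ->
  exists a b : K, [/\ a != 0, b != 0 & a != b].
Proof.
move=> cardK; have [b] : exists b, b \notin [:: 0; 1 : K].
  exact: exists_notin.
rewrite !inE negb_or => /andP[b0 b1].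
by exists 1, b; rewrite oner_neq0 b0 eq_sym.
Qed.

Section PairDegrees.

Variables (m : nat) (F K : finFieldType) (alpha : F) (k : nat).
Hypotheses (cardF : #|F| = (2 ^ m.+1)%N) (cardK : #|K| = (2 ^ m)%N).
Hypotheses (alpha_neq0 : alpha != 0) (k_ge3 : (3 <= k)%N).

Let char2F : 2%N \in [pchar F] := card_finPcharP cardF isT.

(** The conditions on [x], [y] and [alpha] amount to independence over F_2, so some quotient map
    sends [x], [y] to [a], [b]. *)
Lemma pair_degree_transfer x y (a b : K) :
  x \in Vset alpha -> y \in Vset alpha -> x != y -> x + y != alpha ->
  a != 0 -> b != 0 -> a != b ->
  pair_degree (Ublocks alpha k) x y
    = (2 ^ (k - 3) * pair_degree (zero_sum_sets K k) a b)%N.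
Proof.
rewrite !mem_Vset => /andP[x0 xalpha] /andP[y0 yalpha] xy xyalpha a0 b0 ab.
have alphaP : alpha \notin [:: 0; x; y; x + y].
  by rewrite !inE !negb_or alpha_neq0 ![alpha == _]eq_sym xalpha yalpha.
have [p [<- <- p_surj p_ker]] :=
  additive_quotient_map cardF cardK x0 y0 xy alphaP a0 b0 ab.
apply: pair_degree_Ublocks => //.
by rewrite (eq_fiber p_ker) negb_or xy (addrC y) -addr_eq_char2.
Qed.

(** The pair serves twice: as a fixed reference for the degrees in [K], and to exhibit two distinct
    groups. *)
Lemma independent_pair_exists : (1 < m)%N -> exists x y,
  [/\ x \in Vset alpha, y \in Vset alpha, x != y & x + y != alpha].
Proof.
move=> m_gt1; have cardF4 : (4 < #|F|)%N.
  by rewrite cardF (@ltn_exp2l 2 2).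
have [x] : exists x, x \notin [:: 0; alpha].
  by apply: exists_notin; apply: leq_trans cardF4.
have [y] : exists y, y \notin [:: 0; alpha; x; x + alpha].
  exact: exists_notin.
rewrite !inE !negb_or => /and4P[y0 yalpha yx yxalpha] /andP[x0 xalpha].
exists x, y; rewrite ?mem_Vset ?x0 ?y0 //; split=> //.
  by rewrite eq_sym.
by rewrite addrC addr_eq_char2 // addrC.
Qed.

End PairDegrees.

Theorem theorem3p4 (m : nat) (hm : (3 <= m)%N)
    (F : finFieldType) (hF : #|F| = (2 ^ m.+1)%N)
    (K : finFieldType) (hK : #|K| = (2 ^ m)%N)
    (alpha : F) (halpha : alpha != 0)
    (k : nat) (hk3 : (3 <= k)%N) (hkm : (k <= 2 ^ m - 4)%N) :
  exists lambda_k : nat,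
    (forall a b : K, a != 0 -> b != 0 -> a != b ->
       pair_degree (zero_sum_sets K k) a b = lambda_k) /\
    is_GDD (Vset alpha) (Ugroups alpha) (Ublocks alpha k)
      k (2 ^ (k - 3) * lambda_k)%N.
Proof.
have char2F := card_finPcharP hF isT; have char2K := card_finPcharP hK isT.
have [x0 [y0 [x0V y0V xy0 xy0alpha]]] :=
  independent_pair_exists alpha hF (ltnW hm).
have [a0 [b0 [a0n b0n ab0]]] : exists a b : K, [/\ a != 0, b != 0 & a != b].
  by apply: nonzero_pair_exists; rewrite hK (leq_trans _ (leq_pexp2l _ hm)).
set l := pair_degree (zero_sum_sets K k) a0 b0; exists l.
(* Times the positive factor [2 ^ (k - 3)], each degree in [K] equals the block degree of the fixed
   pair [x0], [y0]. *)
have degK a b : a != 0 -> b != 0 -> a != b ->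
    pair_degree (zero_sum_sets K k) a b = l.
  move=> an bn ab; apply/eqP.
  rewrite -(@eqn_pmul2l (2 ^ (k - 3))) ?expn_gt0 //.
  by rewrite -!(pair_degree_transfer hF hK halpha hk3 x0V y0V).
(* A zero-sum [k]-set has two distinct nonzero points, and the degree of that pair is [l]. *)
have l_gt0 : (0 < l)%N.
  have [C CZ] : exists C, C \in zero_sum_sets K k.
    apply: zero_sum_set_exists; rewrite ?hK //.
      by rewrite (dvdn_exp2l 2 (ltnW hm)).
    exact: (leq_pexp2l (m := 2) isT hm).
  have /and3P[/subsetP C0 /eqP cardC _] : [&& C \subset ~: [set 0], #|C| == k
    & \sum_(c in C) c == 0] by rewrite inE in CZ.
  have /card_gt1P[a [b [aC bC ab]]] : (1 < #|C|)%N by rewrite cardC ltnW.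
  have an : a != 0 by have := C0 _ aC; rewrite !inE.
  have bn : b != 0 by have := C0 _ bC; rewrite !inE.
  by rewrite -(degK a b) //; apply/card_gt0P; exists C; rewrite inE CZ aC.
split=> //; split.
- exact: leq_trans hk3.
- by rewrite muln_gt0 expn_gt0.
- exact: partition_Ugroups.
- by move=> B; rewrite inE => /and4P[].
- by move=> B; rewrite inE => /and4P[_ /eqP].
- move=> x y xV yV xy; have same := same_group_Ugroups char2F xV xy.
  have [xyE|xyE] := eqVneq (x + y) alpha; [right | left]; last first.
    split; last by move/same/eqP; apply/negP.
    by apply: (pair_degree_transfer hF hK).
  split; last exact/same.
  suff -> : y = x + alpha by apply: pair_degree_same_group.
  by rewrite -xyE addrA addrr_pchar2 // add0r.
apply/card_gt1P; exists [set x0; x0 + alpha], [set y0; y0 + alpha]; split.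
- by apply/UgroupsP => //; exists x0.
- by apply/UgroupsP => //; exists y0.
apply/eqP=> /setP/(_ y0); rewrite !mem_group eqxx /= eq_sym (negPf xy0) /=.
by rewrite addrC -addr_eq_char2 // addrC; apply/negP.
Qed.
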